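(* For an indeterminate Hamburger moment problem with moments $(s_n)_{n\ge 0}$ the following implications between the properties (c), (ac), (aci), (cs), (cs* ) hold: (i) (cs* ) $\Rightarrow$ (aci) $\Rightarrow$ (ac) $\Rightarrow$ (c); (ii) (cs* ) $\Rightarrow$ (cs).
   Context: Let $\mu$ be a probability measure on $\mathbb{R}$ with infinite support and moments $s_n=\int x^n\,d\mu(x)$ of every order $n\ge 0$. The moment problem is indeterminate if $\mu$ is not the only measure with these moments. Let $P_n(x)=\sum_{k=0}^n b_{k,n}x^k$ ($n\ge0$) be the orthonormal polynomials of $\mu$ with positive leading coefficients, $P_0=1$, and put $b_{k,n}=0$ for $k>n$. In the indeterminate case $K(z,w)=\sum_{n=0}^\infty P_n(z)P_n(w)$ is an entire function of two variables; write $K(z,w)=\sum_{j,k\ge 0}a_{j,k}z^jw^k$. One has $a_{k,l}=\sum_{n\ge\max(k,l)} b_{k,n}b_{l,n}$ (absolutely convergent). Put $c_k=\sqrt{a_{k,k}}=\big(\sum_{n\ge k}b_{k,n}^2\big)^{1/2}<\infty$. For $i,j\ge 0$ consider the series $$\sum_{k=0}^\infty a_{i,k}s_{k+j}. \qquad (\ast)$$ The moment problem has property (c) if all the series $(\ast)$, $i,j\ge0$, are convergent; (ac) if all the series $(\ast)$ are absolutely convergent; (aci) if (ac) holds and the sum of $(\ast)$ equals $\delta_{i,j}$ for all $i,j\ge 0$ (i.e. the infinite matrix product $\{a_{j,k}\}\{s_{j+k}\}$ is the identity matrix); (cs) if $\sum_{n=0}^\infty c_{2n}s_{2n}<\infty$;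 (cs* ) if $\sum_{l=0}^\infty c_l|s_{l+m}|<\infty$ for all $m\ge0$. *)

(* Defs.v *)
(* MathComp-Analysis, over an arbitrary R : realType. *)
From HB Require Import structures.
From mathcomp Require Export all_boot all_order all_algebra.
From mathcomp Require Export complex.
From mathcomp Require Export all_classical all_reals all_analysis.
Export Order.TTheory GRing.Theory Num.Theory.
Export numFieldNormedType.Exports.

Set Implicit Arguments.
Unset Strict Implicit.
Unset Printing Implicit Defensive.

#[global] Open Scope classical_set_scope.
#[global] Open Scope complex_scope.
#[global] Open Scope ring_scope.

Section moments.
Context {R : realType}.
Implicit Type mu : {measure set (measurableTypeR R) -> \bar R}.

Definition has_all_moments mu :=
  forall n : nat, mu.-integrable setT (fun x : R => (x ^+ n)%:E).

Definition moment mu (n : nat) : R := \int[mu]_x (x ^+ n).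

Definition measure_support mu : set R :=
  [set x | forall U : set R, open U -> U x -> (0 < mu U)%E].

(* The competing measure nu is not assumed to be a probability: this is forced
   by moment nu 0 = moment mu 0. *)
Definition indeterminate mu :=
  exists nu : {measure set (measurableTypeR R) -> \bar R},
    [/\ has_all_moments nu,
        forall n, moment nu n = moment mu n
      & exists2 A : set (measurableTypeR R), measurable A & nu A <> mu A].

(* Orthonormality, size (P n) = n.+1 (i.e. degree n) and a positive leading
   coefficient determine the sequence P. The coefficient b_{k,n} of x^k in
   P_n is (P n)`_k. *)
Definition orthonormal_polynomials mu (P : nat -> {poly R}) :=
  [/\ P 0 = 1,
      forall n, size (P n) = n.+1,
      forall n, 0 < lead_coef (P n)
    & forall m n, \int[mu]_x ((P m).[x] * (P n).[x]) = (m == n)%:R].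

End moments.

Section kernel.
Context {R : realType}.
Implicit Types (P : nat -> {poly R}) (a : nat -> nat -> R).

Definition horner_complex (p : {poly R}) (z : R[i]) : R[i] :=
  (map_poly (real_complex R) p).[z].

Definition kernel_sum P (z w : R[i]) : nat -> R[i]^o :=
  series (fun n => horner_complex (P n) z * horner_complex (P n) w : R[i]^o).

Definition kernel P (z w : R[i]) : R[i]^o := limn (kernel_sum P z w).

(* K(z,w) = \sum_(j, k >= 0) a_{j,k} z^j w^k on all of C x C, where K is entire:
   the first clause is absolute convergence of the double power series at every
   point (it suffices to consider |z| = |w| = r); the sum of the series can
   then be computed along the square partial sums. *)
Definition kernel_coefficients P a :=
  [/\ forall r : R,
        summable [set: nat * nat] (fun p => (a p.1 p.2 * r ^+ (p.1 + p.2))%:E),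
      forall z w : R[i], cvgn (kernel_sum P z w)
    & forall z w : R[i],
        (fun N => \sum_(j < N) \sum_(k < N) (a j k)%:C * z ^+ j * w ^+ k : R[i]^o)
          @ \oo --> kernel P z w].

End kernel.

Section properties.
Context {R : realType}.
Variables (a : nat -> nat -> R) (s : nat -> R).

Definition diag_root (k : nat) : R := Num.sqrt (a k k).

Definition inverse_series (i j : nat) : nat -> R :=
  series (fun k => a i k * s (k + j)).

Definition prop_c := forall i j, cvgn (inverse_series i j).

Definition prop_ac :=
  forall i j, cvgn (series (fun k => `|a i k * s (k + j)|)).

Definition prop_aci :=
  prop_ac /\ forall i j, limn (inverse_series i j) = (i == j)%:R.

Definition prop_cs :=
  (\sum_(0 <= n <oo) (diag_root n.*2 * s n.*2)%:E < +oo)%E.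

Definition prop_cs_star :=
  forall m, (\sum_(0 <= l <oo) (diag_root l * `|s (l + m)|)%:E < +oo)%E.

End properties.

(* Main.v *)
(** Write [a_{jk}^L = \sum_(n < L) b_{j,n} b_{k,n}] for the truncated coefficients
    of the kernel. Expanding ['X^j] in the orthonormal polynomials gives, for
    [j < L], the exact finite identity [\sum_(k < L) a_{ik}^L s_{k+j} = delta_{ij}].
    On the unit circle [\sum_(n < L) |P_n|^2] is at most [\sum |a_{jk}|], so the
    [b_{k,.}] are bounded in l^2; hence the [a_{jk}^L] are bounded uniformly in
    [L], which together with the pointwise convergence of the two expansions of
    the kernel forces [a_{jk}^L --> a_{jk}]. Cauchy-Schwarz yields
    [|a_{ik}^L|, |a_{ik}| <= c_i c_k], so under [prop_cs_star] dominated convergence for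
    series lets [L] tend to infinity in the finite identity. *)
Require Import Defs.
From mathcomp Require Import zify ring lra.

(** * Coefficientwise limits from pointwise limits, for uniformly bounded coefficients *)

(** Geometric series: as [z <= 1/2], the bound [2 * M] does not depend on the degree. *)
Lemma norm_horner_le (R : realType) (p : {poly R}) (M z : R) :
  (forall k, `|p`_k| <= M) -> 0 <= z <= 2^-1 -> `|p.[z]| <= 2 * M.
Proof.
move=> + /andP[z0 z1]; elim/poly_ind: p => [|q c IHq] pM.
  by have := pM 0; rewrite horner0 coef0 normr0 => M0; rewrite mulr_ge0.
have qM k : `|q`_k| <= M by have := pM k.+1; rewrite coefD coefMX coefC/= addr0.
have cM : `|c| <= M by have := pM 0; rewrite coefD coefMX coefC/= add0r.
rewrite hornerMXaddC (le_trans (ler_normD _ _))// normrM (ger0_norm z0).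
have := IHq qM; have := normr_ge0 q.[z]; nra.
Qed.

(** Write [p_n(0) = p_n(z) - z q_n(z)] with [|q_n(z)| <= 2 M] for all [n]; first fix a small
    [z > 0], then let [n] grow. *)
Lemma coef0_cvg0 (R : realType) (p : nat -> {poly R}) (M : R) :
  (forall n k, `|(p n)`_k| <= M) ->
  (forall z, 0 < z <= 2^-1 -> (p n).[z] @[n --> \oo] --> 0) ->
  (p n)`_0 @[n --> \oo] --> 0.
Proof.
move=> pM pz; apply/cvgr0Pnorm_le => e e0.
have M0 : 0 <= M by rewrite (le_trans _ (pM 0 0)).
(* Chosen so that [2 * M * z <= e / 2]; the [+ 1] keeps the denominator positive when [M = 0]. *)
pose z := Num.min 2^-1 (e / (4 * M + 1)).
have M1 : 0 < 4 * M + 1 by lra.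
have z0 : 0 < z by rewrite lt_min invr_gt0 ltr0n divr_gt0.
have z1 : z <= 2^-1 by rewrite ge_min lexx.
have zM : z * (4 * M + 1) <= e by rewrite -ler_pdivlMr// ge_min lexx orbT.
have z01 : 0 < z <= 2^-1 by rewrite z0.
have e20 : 0 < e / 2 by rewrite divr_gt0.
near=> n.
have : `|(p n).[z]| <= e / 2.
  by near: n; apply: cvgr0_norm_le => //; exact: pz.
rewrite -{1}(poly_take_drop 1 (p n)) expr1 hornerD hornerMX.
have -> : (take_poly 1 (p n)).[z] = (p n)`_0.
  by rewrite /take_poly horner_poly big_ord1 expr0 mulr1.
have := @norm_horner_le R (drop_poly 1 (p n)) M z.
rewrite (ltW z0) z1 => /(_ _ isT) H.
have {}H : `|(drop_poly 1 (p n)).[z]| <= 2 * M.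
  by apply: H => k; rewrite coef_drop_poly.
move=> {}He; rewrite -(addrK ((drop_poly 1 (p n)).[z] * z) (p n)`_0).
rewrite (le_trans (ler_normB _ _))// normrM (gtr0_norm z0).
have := normr_ge0 (drop_poly 1 (p n)).[z]; nra.
Unshelve. all: by end_near.
Qed.

(* No Cauchy formula is needed: dividing [p_n - p_n(0)] by ['X] preserves both
   hypotheses, so the coefficients are reached one at a time. *)
Lemma coef_cvg0 (R : realType) (p : nat -> {poly R}) (M : R) :
  (forall n k, `|(p n)`_k| <= M) ->
  (forall z, 0 < z <= 2^-1 -> (p n).[z] @[n --> \oo] --> 0) ->
  forall k, (p n)`_k @[n --> \oo] --> 0.
Proof.
move=> + + k; elim: k p => [|k IHk] p pM pz; first exact: coef0_cvg0 pM pz.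
have -> : (fun n => (p n)`_k.+1) = (fun n => (drop_poly 1 (p n))`_k).
  by apply/funext => n; rewrite coef_drop_poly addn1.
apply: IHk => [n i|z z01]; first by rewrite coef_drop_poly.
have z0 : z != 0 by case/andP: z01 => + _; rewrite lt0r => /andP[].
have -> : (fun n => (drop_poly 1 (p n)).[z])
    = (fun n => ((p n).[z] - (p n)`_0) * z^-1).
  apply/funext => n; rewrite -[in RHS](poly_take_drop 1 (p n)) hornerD.
  rewrite expr1 hornerMX coefD coefMX/= addr0 coef_take_poly/=.
  rewrite /take_poly horner_poly big_ord1 expr0 mulr1.
  by rewrite addrAC subrr add0r mulfK.
rewrite -[0 in X in _ --> X](mul0r z^-1) -[X in X * _](subrr 0).
apply: cvgMl; apply: cvgB; [exact: pz|exact: coef0_cvg0 pM pz].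
Qed.

(** [coef_cvg0] is applied once per variable. Cutting off at [n] makes the sums polynomials and
    leaves each fixed entry unchanged for large [n]. *)
Lemma coef2_cvg0 (R : realType) (D : nat -> nat -> nat -> R) (M : R) :
  (forall n j k, `|D n j k| <= M) ->
  (forall z w, 0 < z <= 2^-1 -> 0 < w <= 2^-1 ->
    \sum_(j < n) \sum_(k < n) D n j k * z ^+ j * w ^+ k @[n --> \oo] --> 0) ->
  forall j k, D n j k @[n --> \oo] --> 0.
Proof.
move=> DM D0 j k.
have M0 : 0 <= M by rewrite (le_trans _ (DM 0 0 0)).
have truncM n (E : nat -> R) c i : 0 <= c -> (forall l, `|E l| <= c) ->
    `|(\poly_(l < n) E l)`_i| <= c.
  by move=> c0 Ec; rewrite coef_poly; case: ifP; rewrite ?normr0.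
have trunc (E : nat -> nat -> R) i :
    (\poly_(l < n) E n l)`_i @[n --> \oo] --> 0 ->
    E n i @[n --> \oo] --> 0.
  apply: cvg_trans; apply: near_eq_cvg; near=> n.
  by rewrite coef_poly ifT//; near: n; exact: nbhs_infty_gt.
apply: (trunc (fun n => D n j)).
apply: (@coef_cvg0 _ (fun n => \poly_(l < n) D n j l) M).
  by move=> n i; exact: truncM.
move=> w w01.
(* For fixed [w], this value is the coefficient of [z^j] in a polynomial in [z] whose coefficients
   are bounded by [2 * M]. *)
apply: (trunc (fun n i => (\poly_(l < n) D n i l).[w])).
apply: (@coef_cvg0 _ (fun n => \poly_(i < n) (\poly_(l < n) D n i l).[w])
  (2 * M)).
  move=> n i; apply: (truncM); first by rewrite mulr_ge0.
  move=> l; apply: norm_horner_le; first by move=> m; exact: truncM.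
  by case/andP: w01 => /ltW -> ->.
move=> z z01; apply: cvg_trans (D0 _ _ z01 w01); apply: near_eq_cvg.
apply: nearW => n; rewrite horner_poly; apply: eq_bigr => i _.
by rewrite horner_poly mulr_suml; apply: eq_bigr => l _; rewrite mulrAC.
Unshelve. all: by end_near.
Qed.

(** * Quadratic inequalities: coefficients against values on the unit circle, and Cauchy-Schwarz *)

(* A substitute for Parseval's identity. Split [p = e(X^2) + X o(X^2)] into its
   even and odd parts: by the parallelogram law
   [|p(z)|^2 + |p(-z)|^2 = 2 (|e(z^2)|^2 + |o(z^2)|^2)] on the unit circle. *)
Lemma sum_coef_sq_le (C : numClosedFieldType) (A : C) (L t j : nat)
    (p : nat -> {poly C}) :
  (forall n, (n < L)%N -> (size (p n) <= 2 ^ t)%N) ->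
  (forall u : C, `|u| = 1 -> \sum_(n < L) `|(p n).[u]| ^+ 2 <= A) ->
  \sum_(n < L) `|(p n)`_j| ^+ 2 <= A.
Proof.
elim: t j p => [|t IHt] j p sp pA.
  (* The polynomials are constants here, so their values at [1] are their only coefficients. *)
  apply: le_trans (pA 1 (normr1 _)); apply: ler_sum => n _.
  have /size1_polyC -> := sp n (ltn_ord n).
  by rewrite hornerC coefC; case: eqP => // _; rewrite normr0 expr0n exprn_ge0.
have eo u : `|u| = 1 ->
    \sum_(n < L)
      (`|(even_poly (p n)).[u]| ^+ 2 + `|(odd_poly (p n)).[u]| ^+ 2) <= A.
  move=> u1; pose z := sqrtC u.
  have zu : z ^+ 2 = u by rewrite sqrtCK.
  have z1 : `|z| = 1.
    by apply/eqP; rewrite -(@pexpr_eq1 _ _ 2)// -normrX zu u1.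
  have hz v n : v ^+ 2 = u ->
      (p n).[v] = (even_poly (p n)).[u] + (odd_poly (p n)).[u] * v.
    move=> vu; rewrite -{1}(poly_even_odd (p n)) hornerD hornerMX !horner_comp.
    by rewrite !hornerXn vu.
  have H := lerD (pA z z1) (pA (- z) (etrans (normrN _) z1)).
  rewrite -(ler_pMn2r (ltn0Sn 1)) [A *+ _]mulr2n (le_trans _ H)// -big_split/=.
  rewrite le_eqVlt -sumrMnl; apply/orP; left; apply/eqP/eq_bigr => n _.
  rewrite (hz z)// (hz (- z)) ?sqrrN// mulrN.
  set e := (even_poly _).[u]; set o := (odd_poly _).[u].
  have -> : `|o| ^+ 2 = `|o * z| ^+ 2 by rewrite normrM z1 mulr1.
  by rewrite !normCK rmorphB rmorphD/=; ring.
(* Coefficient [j] of [p n] is coefficient [j./2] of its odd or even part, according to the parity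
   of [j]; passing to that part halves the size bound. *)
have half (q : {poly C} -> {poly C}) :
    (forall r : {poly C}, size r <= 2 ^ t.+1 -> size (q r) <= 2 ^ t)%N ->
    (forall u, `|u| = 1 -> \sum_(n < L) `|(q (p n)).[u]| ^+ 2 <= A) ->
    \sum_(n < L) `|(q (p n))`_(j./2)| ^+ 2 <= A.
  move=> sq qA; apply: (IHt _ (fun n => q (p n))) => // n nL.
  by apply: sq; apply: sp.
have h2 m : (m <= 2 ^ t.+1 -> uphalf m <= 2 ^ t)%N.
  by rewrite expnS => ?; lia.
have := half (@odd_poly C); have := half (@even_poly C).
case: (boolP (odd j)) => jo; [move=> _|move=> + _]; move=> H.
- have -> : \sum_(n < L) `|(p n)`_j| ^+ 2
      = \sum_(n < L) `|(odd_poly (p n))`_(j./2)| ^+ 2.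
    by apply: eq_bigr => n _; rewrite coef_odd_poly; congr (`|_`_ _| ^+ _); lia.
  apply: H => [r rt|u u1].
    by rewrite (leq_trans (size_odd_poly _))//; have := h2 _ rt; lia.
  by apply: le_trans (eo u u1); apply: ler_sum => n _; rewrite lerDr exprn_ge0.
- have -> : \sum_(n < L) `|(p n)`_j| ^+ 2
      = \sum_(n < L) `|(even_poly (p n))`_(j./2)| ^+ 2.
    by apply: eq_bigr => n _; rewrite coef_even_poly; congr (`|_`_ _| ^+ _); lia.
  apply: H => [r rt|u u1].
    by rewrite (leq_trans (size_even_poly _))//; exact: h2.
  by apply: le_trans (eo u u1); apply: ler_sum => n _; rewrite lerDl exprn_ge0.
Qed.

(** Cauchy-Schwarz, read off from [sum (X y_i - S x_i)^2 = X (X Y - S^2)] when [X > 0]. *)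
Lemma sqr_sum_mul_le (R : realFieldType) (n : nat) (x y : nat -> R) :
  (\sum_(i < n) x i * y i) ^+ 2
    <= (\sum_(i < n) x i ^+ 2) * (\sum_(i < n) y i ^+ 2).
Proof.
set X := \sum_(i < n) x i ^+ 2; set Y := \sum_(i < n) y i ^+ 2.
set S := \sum_(i < n) _.
have X0 : 0 <= X by apply: sumr_ge0 => i _; rewrite sqr_ge0.
have [X0'|Xneq0] := eqVneq X 0.
  suff -> : S = 0 by rewrite X0' mul0r expr0n.
  rewrite /S big1// => i _; suff : x i ^+ 2 == 0.
    by rewrite sqrf_eq0 => /eqP ->; rewrite mul0r.
  move/eqP: X0'; rewrite /X psumr_eq0 => [/allP/(_ i)|j _]; last exact: sqr_ge0.
  by rewrite mem_index_enum => /(_ isT).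
have {}X0 : 0 < X by rewrite lt_neqAle eq_sym Xneq0.
have : 0 <= \sum_(i < n) (X * y i - S * x i) ^+ 2.
  by apply: sumr_ge0 => i _; rewrite sqr_ge0.
have -> : \sum_(i < n) (X * y i - S * x i) ^+ 2 = X * (X * Y - S ^+ 2).
  transitivity (\sum_(i < n) (X ^+ 2 * y i ^+ 2 + (- 2 * X * S) * (x i * y i)
      + S ^+ 2 * x i ^+ 2)).
    by apply: eq_bigr => i _; ring.
  by rewrite !big_split/= -!mulr_sumr -/X -/Y -/S; ring.
by rewrite pmulr_rge0// subr_ge0.
Qed.

Lemma cvg_real_complex (R : realType) (u : nat -> R) :
  ((u n)%:C : R[i]^o) @[n --> \oo] --> (0 : R[i]^o) -> u n @[n --> \oo] --> 0.
Proof.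
move=> u0; apply/cvgr0Pnorm_le => e e0.
have e0' : 0 < e%:C :> R[i] by rewrite ltcR.
have /cvgr0Pnorm_le/(_ _ e0') := u0.
apply: filterS => n /=; rewrite normc_def/= expr0n addr0 sqrtr_sqr.
by rewrite lecR.
Qed.

(** * The two expansions of the kernel and the limit of the truncated coefficients *)

Section kernel_expansion.
Context {R : realType} (P : nat -> {poly R}) (a : nat -> nat -> R).
Hypothesis sizeP : forall n, size (P n) = n.+1.
Hypothesis Pa : kernel_coefficients P a.

Definition partial_coef (L j k : nat) : R := \sum_(n < L) (P n)`_j * (P n)`_k.

(** Absolute convergence at [r = 1]: the index squares are finite subsets of the summable family. *)
Lemma kernel_coef_bound : exists A : R,
  forall N, \sum_(j < N) \sum_(k < N) `|a j k| <= A.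
Proof.
have [/(_ 1) + _ _] := Pa; rewrite summableE => h.
exists (fine (\esum_(x in [set: nat * nat])
  `|(a x.1 x.2 * 1 ^+ (x.1 + x.2))%:E|)%E).
move=> N; rewrite -lee_fin (fineK h).
pose r := [seq (j, k) | j <- iota 0 N, k <- iota 0 N].
have ur : uniq r.
  by apply: allpairs_uniq => [||[? ?] [? ?] _ _ []-> ->//]; rewrite iota_uniq.
apply: esum_ge; exists [set` r]; first by split => //; exact: finite_seq.
rewrite -fsbig_seq// /r big_allpairs -sumEFin.
rewrite -(big_mkord xpredT (fun j => (\sum_(k < N) `|a j k|)%:E)).
rewrite /index_iota subn0; apply: lee_sum => j _.
rewrite -(big_mkord xpredT (fun k => `|a j k|)) /index_iota subn0 -sumEFin.
by apply: lee_sum => k _ /=; rewrite expr1n mulr1.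
Qed.

Lemma kernel_partial_cvg (z w : R[i]) :
  (fun N => \sum_(j < N) \sum_(k < N) (a j k)%:C * z ^+ j * w ^+ k
    - kernel_sum P z w N : R[i]^o) @ \oo --> (0 : R[i]^o).
Proof.
have [_ cK aK] := Pa; rewrite -[X in _ --> X](subrr (kernel P z w)).
exact: (cvgB (aK z w) (cK z w)).
Qed.

Lemma kernel_sumE z w L :
  kernel_sum P z w L =
  \sum_(n < L) horner_complex (P n) z * horner_complex (P n) w.
Proof. by rewrite /kernel_sum /series/= big_mkord. Qed.

Lemma horner_complexE (p : {poly R}) (z : R) :
  horner_complex p z%:C = (p.[z])%:C.
Proof. exact: horner_map. Qed.

Lemma partial_coef_sq_bound : exists A : R,
  forall L k, \sum_(n < L) (P n)`_k ^+ 2 <= A.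
Proof.
have [A aA] := kernel_coef_bound; exists A => L k.
rewrite -lecR rmorph_sum/=.
under eq_bigr do rewrite rmorphXn/=.
have normC (x : R) : `|x%:C| ^+ 2 = (x%:C) ^+ 2 :> R[i].
  by rewrite sqr_normc conjc_real expr2.
(* The exponent [t := L] suffices, because [size (P n) <= L < 2 ^ L] for [n < L]. *)
have H := @sum_coef_sq_le R[i] A%:C L L k
  (fun n => map_poly (real_complex R) (P n)).
apply: le_trans (H _ _).
- by apply: ler_sum => n _; rewrite coef_map/= normC.
- by move=> n nL; rewrite size_map_poly sizeP (leq_trans nL)// ltnW// ltn_expl.
(* The kernel sum is close to the double sum only for large [N]; enlarging [L] to [N] adds
   nonnegative terms. *)
move=> u u1; apply/ler_addgt0Pr => e e0.
have := kernel_partial_cvg u u^*%C.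
move=> /cvgr0_norm_le/(_ _ e0) [N0 _ /(_ (maxn L N0))]/=.
rewrite leq_maxr => /(_ isT); set N := maxn L N0.
rewrite kernel_sumE.
have conjP (p : {poly R}) : horner_complex p u^*%C = (horner_complex p u)^*%C.
  rewrite /horner_complex -(horner_map (@conjc R)) -map_poly_comp.
  by congr (_.[_]); apply: eq_map_poly => x; exact/esym/conjc_real.
under [X in _ - X]eq_bigr do rewrite conjP -sqr_normc.
move=> H2.
have LN : (L <= N)%N by rewrite leq_maxl.
apply: (@le_trans _ _ (\sum_(n < N) `|horner_complex (P n) u| ^+ 2)).
  rewrite (big_ord_widen N
    (fun n => `|(map_poly (real_complex R) (P n)).[u]| ^+ 2))//.
  rewrite big_mkcond/=; apply: ler_sum => n _.
  by case: ifP => _; [exact: lexx|exact: exprn_ge0].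
set T := \sum_(j < N) _ in H2.
set S := \sum_(n < N) _ in H2 *.
have S0 : 0 <= S by apply: sumr_ge0 => n _; rewrite exprn_ge0.
have TA : `|T| <= A%:C.
  apply: le_trans (ler_norm_sum _ _ _) _.
  apply: (@le_trans _ _ (\sum_(j < N) \sum_(k < N) `|a j k|%:C)).
    apply: ler_sum => j _; apply: le_trans (ler_norm_sum _ _ _) _.
    apply: ler_sum => i _; rewrite !normrM !normrX normcJ u1 !expr1n !mulr1.
    by rewrite normc_def/= expr0n addr0 sqrtr_sqr.
  under eq_bigr do rewrite -rmorph_sum.
  by rewrite -rmorph_sum lecR.
rewrite -(ger0_norm S0) -(subKr T S) (le_trans (ler_normB _ _))// lerD//.
Qed.

Lemma partial_coefE L k : partial_coef L k k = \sum_(n < L) (P n)`_k ^+ 2.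
Proof. by apply: eq_bigr => n _; rewrite expr2. Qed.

Lemma partial_coef_ge0 L k : 0 <= partial_coef L k k.
Proof. by rewrite partial_coefE; apply: sumr_ge0 => n _; rewrite sqr_ge0. Qed.

Lemma partial_coef_sq L j k :
  partial_coef L j k ^+ 2 <= partial_coef L j j * partial_coef L k k.
Proof.
rewrite !partial_coefE.
exact: (@sqr_sum_mul_le R L (fun n => (P n)`_j) (fun n => (P n)`_k)).
Qed.

(** The differences [a j k - partial_coef L j k] are uniformly bounded, and their truncated double
    power series is the difference of the two expansions, which tends to 0; [coef2_cvg0] applies at
    real points. *)
Lemma partial_coef_cvg j k : partial_coef L j k @[L --> \oo] --> a j k.
Proof.
have [A1 aA1] := kernel_coef_bound; have [A2 bA2] := partial_coef_sq_bound.
suff : (fun L => a j k - partial_coef L j k) @ \oo --> (0 : R).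
  move=> /(cvgB (cvg_cst (a j k))); rewrite subr0.
  by apply: cvg_trans; apply: near_eq_cvg; apply: nearW => L /=; rewrite subKr.
apply: (@coef2_cvg0 _ (fun L j k => a j k - partial_coef L j k) (A1 + A2))
  => {j k}.
- move=> L j k; apply: le_trans (ler_normB _ _) _; apply: lerD.
    apply: le_trans (aA1 (maxn j k).+1).
    have jM : (j < (maxn j k).+1)%N by rewrite ltnS leq_maxl.
    have kM : (k < (maxn j k).+1)%N by rewrite ltnS leq_maxr.
    rewrite (bigD1 (Ordinal jM))//= (bigD1 (Ordinal kM))//= -addrA lerDl.
    by rewrite addr_ge0 ?sumr_ge0// => i _; rewrite sumr_ge0.
  have b0 i : 0 <= partial_coef L i i <= A2.
    by rewrite partial_coef_ge0 partial_coefE bA2.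
  have := partial_coef_sq L j k; have := b0 j; have := b0 k.
  move=> /andP[k0 k2] /andP[j0 j2] H; have A20 : 0 <= A2 := le_trans k0 k2.
  rewrite -(ler_pXn2r (ltn0Sn 1)) ?nnegrE// -normrX ger0_norm ?sqr_ge0//.
  by apply: le_trans H _; rewrite expr2 ler_pM.
move=> z w _ _; apply: cvg_real_complex.
apply: cvg_trans (kernel_partial_cvg z%:C w%:C).
apply: near_eq_cvg; apply: nearW => N /=.
rewrite kernel_sumE.
under [in LHS]eq_bigr do under eq_bigr do rewrite -!rmorphXn -!rmorphM.
under [in LHS]eq_bigr do rewrite -rmorph_sum.
rewrite -rmorph_sum.
under [X in _ - X]eq_bigr do rewrite !horner_complexE -rmorphM.
rewrite -rmorph_sum -rmorphB; congr (_%:C).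
(* As [n < N], the degree of [P n] is below [N], so each product expands entirely inside the [N] by
   [N] square. *)
under [X in _ - X]eq_bigr => n _.
  have Pn : (size (P n) <= N)%N by rewrite sizeP.
  rewrite !(horner_coef_wide _ Pn).
  rewrite mulr_suml.
  under eq_bigr do rewrite mulr_sumr.
  over.
rewrite [X in _ - X]exchange_big/= -sumrB; apply: eq_bigr => i _.
rewrite [X in _ - X]exchange_big/= -sumrB; apply: eq_bigr => l _.
rewrite !mulrBl /partial_coef !mulr_suml; congr (_ - _); apply: eq_bigr => n _.
by rewrite mulrACA -!mulrA.
Qed.

(** On the diagonal, raising [L] adds squares, so the limit [a k k] is an upper bound. *)
Lemma partial_coef_diag_le L k : partial_coef L k k <= a k k.
Proof.
have := @partial_coef_cvg k k => /cvg_lim <- //.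
apply: (@nondecreasing_cvgn_le _ (fun L => partial_coef L k k));
  last by apply: cvgP; exact: partial_coef_cvg.
apply/nondecreasing_seqP => n; rewrite /partial_coef big_ord_recr/= lerDl.
by rewrite -expr2 sqr_ge0.
Qed.

Lemma partial_coef_le L j k :
  `|partial_coef L j k| <= diag_root a j * diag_root a k.
Proof.
have a0 i : 0 <= a i i :=
  le_trans (partial_coef_ge0 L i) (partial_coef_diag_le L i).
rewrite -sqrtr_sqr /diag_root -sqrtrM// ler_wsqrtr//.
apply: le_trans (partial_coef_sq L j k) _.
by apply: ler_pM; rewrite ?partial_coef_ge0 ?partial_coef_diag_le.
Qed.

Lemma kernel_coef_le j k : `|a j k| <= diag_root a j * diag_root a k.
Proof.
have ajk : `|partial_coef L j k| @[L --> \oo] --> `|a j k|.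
  by apply: cvg_norm; exact: partial_coef_cvg.
rewrite -(cvg_lim _ ajk)//; apply: limr_le; first exact: cvgP ajk.
by apply: nearW => L; exact: partial_coef_le.
Qed.

End kernel_expansion.

(** * Dominated convergence for series *)

(** The range of summation grows with [n]: cut at a fixed [m] beyond which [g] contributes less than
    [e / 2], and use termwise convergence on the finite head. *)
Lemma tannery_cvg0 (R : realType) (d : nat -> nat -> R) (g : nat -> R) :
  (forall n k, `|d n k| <= g k) -> cvgn (series g) ->
  (forall k, d n k @[n --> \oo] --> 0) ->
  \sum_(k < n) d n k @[n --> \oo] --> 0.
Proof.
move=> dg cg d0; apply/cvgr0Pnorm_le => e e0.
have e20 : 0 < e / 2 by rewrite divr_gt0.
have /cauchy_cvgP/cauchy_seriesP/(_ _ e20) := cg.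
move=> [[U V] /= [[N1 _ NU] [N2 _ NV]] UV].
pose m := maxn N1 N2.
have tail n : `|\sum_(m <= k < n) g k| < e / 2.
  have [mn|/ltnW nm] := leqP m n; last by rewrite big_geq// normr0.
  apply: (UV (m, n)); split; [apply: NU|apply: NV] => /=.
    by rewrite leq_maxl.
  by rewrite (leq_trans _ mn)// leq_maxr.
have head : \sum_(k < m) d n k @[n --> \oo] --> 0.
  elim: m {tail} => [|m IHm].
    by under eq_fun do rewrite big_ord0; exact: cvg_cst.
  under eq_fun do rewrite big_ord_recr/=.
  suff : (\sum_(k < m) d n k + d n m) @[n --> \oo] --> (0 + 0 : R).
    by rewrite addr0.
  exact: cvgD.
near=> n.
have mn : (m <= n)%N by near: n; exact: nbhs_infty_ge.
rewrite -(big_mkord xpredT) (big_cat_nat _ mn)//= big_mkord.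
rewrite (splitr e) (le_trans (ler_normD _ _))// lerD//.
  by near: n; exact: cvgr0_norm_le.
apply: le_trans (ltW (tail n)); apply: le_trans (ler_norm_sum _ _ _) _.
apply: le_trans (ler_norm _); exact: ler_sum.
Unshelve. all: by end_near.
Qed.

(** * The moment functional, Fourier expansion and the finite inverse identity *)

Section moment_functional.
Context {R : realType} (mu : {measure set (measurableTypeR R) -> \bar R}).
Hypothesis mu_moments : has_all_moments mu.

(** Defined through the moments so that linearity concerns finite sums; integration enters only
    through orthonormality. *)
Definition moment_functional (p : {poly R}) : R :=
  \sum_(k < size p) p`_k * moment mu k.

Lemma moment_functional_wide n (p : {poly R}) : (size p <= n)%N ->
  moment_functional p = \sum_(k < n) p`_k * moment mu k.
Proof.
move=> pn; rewrite /moment_functional.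
rewrite (big_ord_widen n (fun k => p`_k * moment mu k))//.
rewrite big_mkcond/=; apply: eq_bigr => k _; case: ifPn => //.
rewrite -leqNgt => pk.
by rewrite nth_default// mul0r.
Qed.

Lemma moment_functionalD p q :
  moment_functional (p + q) = moment_functional p + moment_functional q.
Proof.
pose n := maxn (size p) (size q).
rewrite (@moment_functional_wide n (p + q)) ?size_polyD//.
rewrite (@moment_functional_wide n p) ?leq_maxl//.
rewrite (@moment_functional_wide n q) ?leq_maxr//.
by rewrite -big_split/=; apply: eq_bigr => k _; rewrite coefD mulrDl.
Qed.

Lemma moment_functionalZ c p :
  moment_functional (c *: p) = c * moment_functional p.
Proof.
rewrite (@moment_functional_wide (size p)) ?size_scale_leq//.
by rewrite mulr_sumr; apply: eq_bigr => k _; rewrite coefZ mulrA.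
Qed.

Lemma moment_functional_integral p : moment_functional p = \int[mu]_x p.[x].
Proof.
have integ (c : R) (k : nat) :
    mu.-integrable setT (fun x : measurableTypeR R => (c * x ^+ k)%:E).
  by under eq_fun do rewrite EFinM; exact: integrableZl.
rewrite /Rintegral.
under eq_integral do rewrite horner_coef -sumEFin.
rewrite integral_sum// -sum_fine => [|k _]; last exact: integrable_fin_num.
by apply: eq_bigr => k _; rewrite -RintegralZl//; exact: mu_moments.
Qed.

Context (P : nat -> {poly R}).
Hypothesis P_orth : orthonormal_polynomials mu P.

Lemma moment_functional_orth m n : moment_functional (P m * P n) = (m == n)%:R.
Proof.
have [_ _ _ <-] := P_orth; rewrite moment_functional_integral.
by under eq_Rintegral do rewrite hornerM.
Qed.

Lemma orthonormal_span n (p : {poly R}) : (size p <= n)%N ->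
  exists t : nat -> R, p = \sum_(m < n) t m *: P m.
Proof.
have [_ sizeP leadP _] := P_orth.
elim: n p => [|n IHn] p pn.
  exists (fun=> 0); rewrite big_ord0.
  by apply/eqP; rewrite -size_poly_eq0 -leqn0.
(* Cancels the coefficient of degree [n]; the divisor is the positive leading coefficient of
   [P n]. *)
pose c := p`_n / (P n)`_n.
have [|t tE] := IHn (p - c *: P n).
  apply/leq_sizeP => k; rewrite leq_eqVlt => /predU1P[<-|nk].
    rewrite coefB coefZ /c divfK ?subrr//.
    by have := leadP n; rewrite lead_coefE sizeP/= lt0r => /andP[].
  by rewrite coefB coefZ !nth_default ?mulr0 ?subrr// ?sizeP// (leq_trans pn).
exists (fun m => if m == n then c else t m).
rewrite big_ord_recr/= eqxx -[LHS](subrK (c *: P n)); congr (_ + _).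
by rewrite tE; apply: eq_bigr => m _; rewrite ltn_eqF.
Qed.

Lemma fourier_expansion n (p : {poly R}) : (size p <= n)%N ->
  p = \sum_(m < n) moment_functional (p * P m) *: P m.
Proof.
move=> /orthonormal_span[t pE]; rewrite {1}pE; apply: eq_bigr => m _.
congr (_ *: _); rewrite pE mulr_suml.
have l0 : moment_functional 0 = 0.
  by rewrite /moment_functional size_poly0 big_ord0.
rewrite (big_morph _ moment_functionalD l0) (bigD1 m)//= big1 => [|i im].
  rewrite addr0 -scalerAl moment_functionalZ moment_functional_orth.
  by rewrite eqxx mulr1.
rewrite -scalerAl moment_functionalZ moment_functional_orth.
by rewrite (negbTE im : (_ == _ :> nat) = _) mulr0.
Qed.

(** The sum [sum_k b_{k,m} s_{k+j}] is the Fourier coefficient of ['X^j] along [P m]. The claim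
    compares coefficients of degree [i] in the expansion of ['X^j], exact because [j < n]. *)
Lemma partial_coef_inverse n i j : (j < n)%N ->
  \sum_(k < n) partial_coef P n i k * moment mu (k + j) = (i == j)%:R.
Proof.
move=> jn; have [_ sizeP _ _] := P_orth.
have -> : (i == j)%:R = ('X^j : {poly R})`_i by rewrite coefXn.
rewrite [in RHS](@fourier_expansion n 'X^j) ?size_polyXn// coef_sum.
under eq_bigr do rewrite /partial_coef mulr_suml.
rewrite exchange_big/=; apply: eq_bigr => m _; rewrite coefZ [RHS]mulrC.
under eq_bigr do rewrite -mulrA; rewrite -mulr_sumr; congr (_ * _).
(* The lowest [j] coefficients of ['X^j * P m] vanish; the others are those of [P m] shifted by
   [j]. *)
rewrite (@moment_functional_wide (j + n)).
  rewrite big_split_ord/= [X in _ = X + _]big1 ?add0r => [|k _];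
    last by rewrite coefXnM ltn_ord mul0r.
  by apply: eq_bigr => k _; rewrite coefXnM ltnNge leq_addr/= addKn addnC.
rewrite (leq_trans (size_polyMleq _ _))// size_polyXn sizeP addSn/=.
by rewrite leq_add2l.
Qed.

End moment_functional.

(** * The implications between the properties *)

Lemma cvg_series_nneg (R : realType) (u : nat -> R) : (forall n, 0 <= u n) ->
  (\sum_(0 <= n <oo) (u n)%:E < +oo)%E -> cvgn (series u).
Proof.
move=> u0 uoo; apply: nondecreasing_is_cvgn.
  by apply: nondecreasing_series => n _ _; exact: u0.
have ufin : (\sum_(0 <= n <oo) (u n)%:E)%E \is a fin_num.
  by rewrite ge0_fin_numE//; apply: nneseries_ge0 => n _ _; rewrite lee_fin.
exists (fine (\sum_(0 <= n <oo) (u n)%:E)%E) => _ [n _ <-].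
rewrite -lee_fin (fineK ufin) /series/= -sumEFin.
by apply: nneseries_lim_ge => k _ _; rewrite lee_fin.
Qed.

Lemma moment_even_ge0 (R : realType)
    (mu : {measure set (measurableTypeR R) -> \bar R}) (n : nat) :
  0 <= moment mu n.*2.
Proof.
apply: Rintegral_ge0 => x _.
by rewrite -mul2n exprM; apply: exprn_ge0; exact: sqr_ge0.
Qed.

Theorem theorem1p2 (R : realType) (mu : probability (measurableTypeR R) R)
    (P : nat -> {poly R}) (a : nat -> nat -> R) :
  has_all_moments mu ->
  infinite_set (measure_support mu) ->
  indeterminate mu ->
  orthonormal_polynomials mu P ->
  kernel_coefficients P a ->
  [/\ prop_cs_star a (moment mu) -> prop_aci a (moment mu),
      prop_aci a (moment mu) -> prop_ac a (moment mu),
      prop_ac a (moment mu) -> prop_c a (moment mu)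
    & prop_cs_star a (moment mu) -> prop_cs a (moment mu)].
Proof.
move=> mu_moments _ _ P_orth Pa; have [_ sizeP _ _] := P_orth.
have c0 k : 0 <= diag_root a k by exact: sqrtr_ge0.
have cs_cvg m : prop_cs_star a (moment mu) ->
    cvgn (series (fun l => diag_root a l * `|moment mu (l + m)|)).
  by move=> /(_ m); apply: cvg_series_nneg => l; rewrite mulr_ge0.
have aM i k m : `|a i k * moment mu (k + m)|
    <= diag_root a i * (diag_root a k * `|moment mu (k + m)|).
  rewrite normrM mulrA; apply: ler_wpM2r => //.
  exact: (kernel_coef_le _ _ sizeP Pa).
have scaled_cvg i m : prop_cs_star a (moment mu) ->
    cvgn (series (fun l =>
      diag_root a i * (diag_root a l * `|moment mu (l + m)|))).
  by move=> /(cs_cvg m) ?; exact: is_cvg_seriesZ.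
have star_ac : prop_cs_star a (moment mu) -> prop_ac a (moment mu).
  move=> cs i j; apply: (series_le_cvg _ _ _ (scaled_cvg i j cs)) => k //.
  by rewrite !mulr_ge0.
split; last 1 first.
- move=> cs; apply: le_lt_trans (cs 0).
  have cs0 n : (0 <= (diag_root a n.*2 * moment mu n.*2)%:E)%E.
    by rewrite lee_fin mulr_ge0// moment_even_ge0.
  apply: lime_le; first by apply: is_cvg_nneseries => n _ _; exact: cs0.
  apply: nearW => N; apply: le_trans (nneseries_lim_ge N.*2 _); last first.
    by move=> l _ _; rewrite lee_fin mulr_ge0.
  elim: N => [|N IHN]; first by rewrite !big_geq.
  rewrite doubleS !big_nat_recr//= addn0 -[leLHS]adde0; apply: leeD.
    by apply: leeD IHN _; rewrite lee_fin ler_wpM2l// ler_norm.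
  by rewrite lee_fin mulr_ge0.
- move=> cs; split; first exact: star_ac.
  move=> i j; apply/cvg_lim => //.
  pose d n k := (a i k - partial_coef P n i k) * moment mu (k + j).
  have : \sum_(k < n) d n k @[n --> \oo] --> 0.
    (* The factor 2 arises because [c_i c_k] bounds both [a i k] and its truncation. *)
    apply: (@tannery_cvg0 _ d (fun k =>
      2 * (diag_root a i * (diag_root a k * `|moment mu (k + j)|)))).
    + move=> n k; rewrite /d normrM !mulrA; apply: ler_wpM2r => //.
      rewrite -mulrA mulr_natl mulr2n (le_trans (ler_normB _ _))// lerD//.
        exact: (kernel_coef_le _ _ sizeP Pa).
      exact: (partial_coef_le _ _ sizeP Pa).
    + by apply: is_cvg_seriesZ; exact: scaled_cvg.
    + move=> k.
      suff : (a i k - partial_coef P n i k) * moment mu (k + j) @[n --> \oo]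
          --> (a i k - a i k) * moment mu (k + j) by rewrite subrr mul0r.
      apply: cvgMl; apply: cvgB; first exact: cvg_cst.
      exact: (partial_coef_cvg _ _ sizeP Pa).
  move=> d0.
  have : \sum_(k < n) d n k + (i == j)%:R @[n --> \oo]
      --> (0 + (i == j)%:R : R).
    by apply: cvgD => //; exact: cvg_cst.
  rewrite add0r; apply: cvg_trans; apply: near_eq_cvg; near=> n.
  (* Once [n > j], the finite identity turns [sum d + delta_{ij}] into the partial sum of the
     inverse series. *)
  rewrite -(@partial_coef_inverse _ _ mu_moments _ P_orth n); last first.
    by near: n; exact: nbhs_infty_gt.
  rewrite -big_split/= /inverse_series /series/= big_mkord.
  by apply: eq_bigr => k _; rewrite /d -mulrDl subrK.
- by case.
- by move=> ac i j; apply: normed_cvg; exact: ac.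
Unshelve. all: by end_near.
Qed.
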